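(* If $G$ is a triangle-free $K_4$-minor-free graph, then $G$ is $(2,2,1)$-AT extendable with respect to $(x,y,z)$ for all distinct vertices $x,y,z\in V(G)$.
   Context: All graphs are finite and simple. For an orientation $D$ of a graph $G$, an Eulerian sub-digraph of $D$ is a spanning sub-digraph $F$ of $D$ with $d^+_F(v)=d^-_F(v)$ for every vertex $v$. Let $\mathrm{diff}(D)$ be the number of Eulerian sub-digraphs of $D$ with an even number of arcs minus the number with an odd number of arcs; $D$ is an AT-orientation if $\mathrm{diff}(D)\neq 0$. For $f:V(G)\to\mathbb{N}$, $G$ is $f$-AT if $G$ has an AT-orientation $D$ with $d^+_D(v)\le f(v)-1$ for every vertex $v$. Given distinct vertices $v_1,\dots,v_k$ and integers $a_i\in\{1,2\}$, define $f(v_i)=a_i$ for $i\in[k]$ and $f(v)=3$ for all other vertices; $G$ is $(a_1,\dots,a_k)$-AT extendable with respect to $(v_1,\dots,v_k)$ if $G$ is $f$-AT. *)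

(* Defs.v *)
From mathcomp Require Import all_boot all_order all_algebra.
Set Implicit Arguments. Unset Strict Implicit. Unset Printing Implicit Defensive.
Import GRing.Theory Num.Theory.

Section Defs.
Variable T : finType.

Definition simple_graph (e : rel T) : Prop := symmetric e /\ irreflexive e.

Definition outdeg (F : {set T * T}) (v : T) : nat := #|[set a in F | a.1 == v]|.
Definition indeg  (F : {set T * T}) (v : T) : nat := #|[set a in F | a.2 == v]|.

Definition orientation (e : rel T) (D : {set T * T}) : Prop :=
  (forall x y, (x, y) \in D -> e x y) /\
  (forall x y, e x y -> ((x, y) \in D) != ((y, x) \in D)).

Definition eulerian_sub (D F : {set T * T}) : bool :=
  (F \subset D) && [forall v, outdeg F v == indeg F v].

Definition diffE (D : {set T * T}) : int :=
  (\sum_(F : {set T * T} | eulerian_sub D F) (-1) ^+ #|F|)%R.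

Definition AT_orientation (D : {set T * T}) : Prop := diffE D != 0%R.

Definition f_AT (e : rel T) (f : T -> nat) : Prop :=
  exists D, [/\ orientation e D, AT_orientation D & forall v, outdeg D v < f v].

Definition triangle_free (e : rel T) : Prop :=
  forall x y z, ~ [/\ e x y, e y z & e x z].

Definition connected_set (e : rel T) (S : {set T}) : Prop :=
  forall x y, x \in S -> y \in S ->
    connect [rel u v | [&& e u v, u \in S & v \in S]] x y.

Definition has_K4_minor (e : rel T) : Prop :=
  exists B : 'I_4 -> {set T},
    (forall i, B i != set0 /\ connected_set e (B i)) /\
    (forall i j, i != j ->
       [disjoint B i & B j] /\ exists x y, [/\ x \in B i, y \in B j & e x y]).

Definition f3 (x y z : T) (a b c : nat) (v : T) : nat :=
  if v == x then a else if v == y then b else if v == z then c else 3.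

Definition AT_extendable3 (e : rel T) (a b c : nat) (x y z : T) : Prop :=
  f_AT e (f3 x y z a b c).

End Defs.

(* Main.v *)
Require Import Defs.
From mathcomp Require Import all_boot all_order all_algebra.
Set Implicit Arguments. Unset Strict Implicit. Unset Printing Implicit Defensive.

(* In a K4-minor-free graph, every edge uv with some further non-isolated vertex
   leaves a vertex of degree 1 or 2 outside {u, v}. Indeed, in a minimal
   counterexample the contraction of an edge other than uv must spoil a degree, so
   that edge has a common neighbour of degree 3 outside {u, v} unless its ends are
   twins; pursuing this locally always yields K4 or a smaller counterexample.

   Let G be triangle-free, K4-minor-free, without vertices of degree 1 and with at
   most three vertices of degree 2. Suppressing a vertex of degree 2 keeps all other
   degrees, and the new edge serves as uv in the previous statement, which supplies
   the next vertex to suppress. Three suppressions would exhaust the vertices of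
   degree 2 and give a contradiction, so a suppression must fail to create a new
   edge, i.e. two vertices of degree 2 have the same neighbours; then G is K_{2,3}.

   For the theorem, a vertex of degree less than f can be removed and put back as a
   source, and z, if it has degree 1, as a sink, its neighbour u then playing the
   role of z (or of x or y, if u is one of them, with the roles exchanged). Neither
   changes the Eulerian sub-digraphs. The only remaining graph with an edge is
   K_{2,3} with x, y, z on the side of size 3; it is bipartite, so all its Eulerian
   sub-digraphs are even and any orientation with the right degrees will do. *)

(** * Degrees, and K4-minors under deletion, contraction and suppression *)

Section Graph.
Variable T : finType.
Implicit Types (e : rel T) (u v w x y : T).

Definition nb e v : {set T} := [set u | e v u].
Definition deg e v := #|nb e v|.
Definition nonisolated e : {set T} := [set v | 0 < deg e v].

(* [T] being fixed, a deleted, contracted or suppressed vertex stays as an isolated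
   one; isolated vertices are disregarded throughout. *)
Definition del_vertex e w : rel T := fun u v => [&& u != w, v != w & e u v].

(* merges [y] into [x] *)
Definition contract e x y : rel T := fun u v =>
  [&& u != y, v != y, u != v & [|| e u v, (u == x) && e y v | (v == x) && e y u]].

(* meant for a vertex [w] with neighbours [a] and [b] *)
Definition suppress e w a b : rel T := fun u v =>
  [&& u != w, v != w & [|| e u v, (u == a) && (v == b) | (u == b) && (v == a)]].

Lemma in_nb e u v : (u \in nb e v) = e v u. Proof. by rewrite inE. Qed.

Lemma deg_gt0 e v : reflect (exists u, e v u) (0 < deg e v).
Proof. by apply: (iffP card_gt0P) => -[u]; rewrite ?inE => ?; exists u; rewrite ?inE. Qed.

Lemma deg_pos e u v : e v u -> 0 < deg e v.
Proof. by move=> h; apply/deg_gt0; exists u. Qed.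

Lemma sub_K4_minor e e' : subrel e' e -> has_K4_minor e' -> has_K4_minor e.
Proof.
move=> se [B [B1 B2]]; exists B; split=> [i|i j ij].
  have [B0 Bc] := B1 i; split=> // p q pB qB; apply: connect_sub (Bc p q pB qB).
  by move=> s t /and3P[est sB tB]; apply: connect1; rewrite /= se ?sB.
have [d [p [q [pB qB epq]]]] := B2 i j ij; split=> //.
by exists p, q; split=> //; apply: se.
Qed.

Lemma contract_K4_minor e x y : symmetric e -> e x y ->
  has_K4_minor (contract e x y) -> has_K4_minor e.
Proof.
move=> sym exy [B [B1 B2]].
(* As [y] is isolated in the contraction, its membership in [B i] carries no information; it is made
   to follow [x]. *)
pose C i := [set v in B i | v != y] :|: [set v | (v == y) && (x \in B i)].
have inC i v : v \in C i = (if v == y then x \in B i else v \in B i).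
  by rewrite !inE; case: eqP => _ /=; rewrite ?andbT ?orbF ?andbF.
exists C; split=> [i|i j ij]; last first.
  have [d [p [q [pB qB /and4P[py qy _ epq]]]]] := B2 i j ij; split.
    apply/pred0P => v /=; rewrite !inC; case: eqP => _; exact: (pred0P d _).
  case/or3P: epq => [epq|/andP[/eqP px epq]|/andP[/eqP qx epq]].
  - by exists p, q; rewrite !inC (negPf py) (negPf qy).
  - by exists y, q; rewrite !inC eqxx (negPf qy) -px.
  - by exists p, y; rewrite !inC eqxx (negPf py) -qx sym.
have [_ Bc] := B1 i.
(* An edge of the contraction that is absent from [e] becomes a path of length 2 through [y]. *)
have conB p q : p \in B i -> q \in B i ->
    connect [rel u v | [&& e u v, u \in C i & v \in C i]] p q.
  move=> pB qB; apply: connect_sub (Bc p q pB qB) => s t /and3P[].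
  move=> /and4P[sy ty _ est] sB tB.
  case/or3P: est => [est|/andP[/eqP sx est]|/andP[/eqP tx est]].
  - by apply: connect1; rewrite /= est !inC (negPf sy) (negPf ty) sB.
  - apply: (@connect_trans _ _ y); apply: connect1 => /=.
      by rewrite sx exy !inC eqxx -sx (negPf sy) sB.
    by rewrite est !inC eqxx (negPf ty) -sx sB.
  - apply: (@connect_trans _ _ y); apply: connect1 => /=.
      by rewrite sym est !inC eqxx -tx (negPf sy) sB.
    by rewrite tx sym exy !inC eqxx -tx (negPf ty) tB.
have proj p : p \in C i -> exists2 p', p' \in B i &
    connect [rel u v | [&& e u v, u \in C i & v \in C i]] p p' &&
    connect [rel u v | [&& e u v, u \in C i & v \in C i]] p' p.
  rewrite {1}inC; case: eqP => [-> xB|_ pB]; last by exists p; rewrite ?connect0.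
  exists x => //; have xC : x \in C i by rewrite inC; case: eqP.
  have yC : y \in C i by rewrite inC eqxx.
  by apply/andP; split; apply: connect1; rewrite /= xC yC ?andbT // sym.
split.
  (* That [B i] is nonempty does not suffice, since its element might be [y]; the end of an edge to
     another branch set cannot be. *)
  have [j ij] : exists j, i != j.
    by exists (if i == ord0 then ord_max else ord0); case: (eqVneq i ord0) => [->|].
  have [_ [p [q [pB qB /and4P[py qy _ _]]]]] := B2 i j ij.
  by apply/set0Pn; exists p; rewrite inC (negPf py).
move=> p q /proj[p' pB /andP[c1 _]] /proj[q' qB /andP[_ c2]].
exact: connect_trans c1 (connect_trans (conB _ _ pB qB) c2).
Qed.

Lemma simple_contract e x y : simple_graph e -> simple_graph (contract e x y).
Proof.
case=> sym irr; split=> [u v|u]; last by rewrite /contract eqxx !andbF.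
rewrite /contract (sym v u) (eq_sym v u).
by case: (u == y) (v == y) (u == v) (e u v) => [] [] [] [] //=; rewrite orbC.
Qed.

Lemma simple_del_vertex e w : simple_graph e -> simple_graph (del_vertex e w).
Proof.
by case=> sym irr; split=> [u v|u]; rewrite /del_vertex ?irr ?andbF // (sym v u) andbCA.
Qed.

Lemma simple_suppress e w a b : simple_graph e -> a != b -> simple_graph (suppress e w a b).
Proof.
case=> sym irr ab; split=> [u v|u].
  by rewrite /suppress (sym v u) andbCA; congr [&& _, _ & _ || _]; rewrite orbC ![(v == _) && _]andbC.
by rewrite /suppress irr; case: (eqVneq u a) => [->|] /=; rewrite ?(negPf ab) ?andbF.
Qed.

Lemma sub_del_vertex e w : subrel (del_vertex e w) e. Proof. by move=> u v /and3P[]. Qed.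

Lemma del_vertex_K4_minor e w : has_K4_minor (del_vertex e w) -> has_K4_minor e.
Proof. exact/sub_K4_minor/sub_del_vertex. Qed.

(** The suppressed graph is a subgraph of the contraction of [w] into [a]. *)
Lemma suppress_K4_minor e w a b : simple_graph e -> e w a -> e w b -> a != b ->
  has_K4_minor (suppress e w a b) -> has_K4_minor e.
Proof.
move=> [sym irr] wa wb ab H; apply: (@contract_K4_minor e a w); rewrite // 1?sym //.
apply: sub_K4_minor H => u v /and3P[uw vw] /or3P[euv|/andP[/eqP-> /eqP->]|/andP[/eqP-> /eqP->]].
- by rewrite /contract uw vw euv andbT; apply: contraTneq euv => ->; rewrite irr.
- rewrite /contract ab (sym a) wb eqxx /= orbT !andbT.
  by apply/andP; split; [apply: contraTneq wa|apply: contraTneq wb] => ->; rewrite irr.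
- rewrite /contract [b == a]eq_sym ab wb eqxx /= !orbT !andbT.
  by apply/andP; split; [apply: contraTneq wb|apply: contraTneq wa] => ->; rewrite irr.
Qed.

Lemma deg_del_vertex e w v : v != w -> deg e v = e v w + deg (del_vertex e w) v.
Proof.
move=> vw; rewrite /deg (cardsD1 w) in_nb; congr (_ + #|pred_of_set _|).
by apply/setP=> u; rewrite !inE /del_vertex vw.
Qed.

(** Each of [a] and [b] trades its neighbour [w] for the other one, which is a new neighbour because
    [a] and [b] were not adjacent. *)
Lemma deg_suppress e w a b v : simple_graph e -> nb e w = [set a; b] -> ~~ e a b -> a != b ->
  v != w -> deg (suppress e w a b) v = deg e v.
Proof.
move=> [sym irr] nw nab ab vw.
have ew u : e w u = (u == a) || (u == b) by rewrite -in_nb nw !inE.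
have aw : a != w by apply: contraFneq (irr w) => E; rewrite -{2}E ew eqxx.
have bw : b != w by apply: contraFneq (irr w) => E; rewrite -{2}E ew eqxx orbT.
have [va|va] := eqVneq v a; last have [vb|vb] := eqVneq v b.
- rewrite /deg (cardsD1 w (nb e v)) in_nb va sym ew eqxx /=.
  rewrite (_ : nb _ _ = b |: (nb e a :\ w)) ?cardsU1 ?in_setD1 ?in_nb ?(negPf nab) ?andbF //.
  apply/setP=> u; rewrite !inE /suppress aw eqxx (negPf ab) /= orbF.
  by have [->|] := eqVneq u b; rewrite ?bw ?orbT //= orbF.
- rewrite /deg (cardsD1 w (nb e v)) in_nb vb sym ew eqxx orbT /=.
  rewrite (_ : nb _ _ = a |: (nb e b :\ w)) ?cardsU1 ?in_setD1 ?in_nb 1?sym ?(negPf nab) ?andbF //.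
  apply/setP=> u; rewrite !inE /suppress bw eqxx [b == a]eq_sym (negPf ab) /=.
  by have [->|] := eqVneq u a; rewrite ?aw ?orbT //= orbF.
- rewrite /deg; congr #|pred_of_set _|; apply/setP=> u.
  rewrite !inE /suppress vw (negPf va) (negPf vb) /= orbF.
  by have [->|//] := eqVneq u w; rewrite sym ew (negPf va) (negPf vb).
Qed.

Lemma deg_contract e x y v : simple_graph e -> e x y -> v != x -> v != y ->
  deg e v = deg (contract e x y) v + (e v x && e v y).
Proof.
move=> [sym irr] exy vx vy.
have xy : x != y by apply: contraTneq exy => ->; rewrite irr.
have N u : contract e x y v u = [&& u != y, v != u & e v u || (u == x) && e y v].
  by rewrite /contract vy (negPf vx).
have irrv u : e v u -> v != u by apply: contraTneq => ->; rewrite irr.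
rewrite /deg (cardsD1 y (nb e v)) in_nb [e v y]sym; case eyv: (e y v) => /=.
  rewrite (_ : nb (contract e x y) v = x |: (nb e v :\ y)); last first.
    apply/setP=> u; rewrite !inE N eyv andbT.
    have [->|ux] := eqVneq u x; first by rewrite xy vx orbT.
    by rewrite orbF; case: (u == y) => //=; case E: (e v u); rewrite ?andbF ?irrv.
  by rewrite cardsU1 in_setD1 in_nb xy /= andbT; case: (e v x); rewrite ?addn0 // addnC.
rewrite andbF addn0; congr #|pred_of_set _|; apply/setP=> u.
rewrite !inE N eyv andbF orbF; case: (u == y) => //=.
by case E: (e v u); rewrite ?andbF ?irrv.
Qed.

Lemma nb_contract e x y : irreflexive e -> e x y ->
  nb (contract e x y) x = (nb e x :|: nb e y) :\ x :\ y.
Proof.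
move=> irr exy.
have xy : x != y by apply: contraTneq exy => ->; rewrite irr.
apply/setP=> u; rewrite !inE /contract eqxx xy /= [x == u]eq_sym.
by case: (eqVneq u x); rewrite ?andbF ?orbF.
Qed.

Lemma deg_contract0 e x y : deg (contract e x y) y = 0.
Proof. by apply: eq_card0 => u; rewrite !inE /contract eqxx. Qed.
Lemma deg_del_vertex0 e w : deg (del_vertex e w) w = 0.
Proof. by apply: eq_card0 => u; rewrite !inE /del_vertex eqxx. Qed.
Lemma deg_suppress0 e w a b : deg (suppress e w a b) w = 0.
Proof. by apply: eq_card0 => u; rewrite !inE /suppress eqxx. Qed.

(** This is the decrease of the induction measure: [w] becomes isolated, and edges are created only
    at vertices that already had some. *)
Lemma card_nonisolated_lt e e' w : 0 < deg e w ->
  (forall p q, e' p q -> p != w /\ 0 < deg e p) -> #|nonisolated e'| < #|nonisolated e|.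
Proof.
move=> w0 H; apply: proper_card; apply/properP; split.
  by apply/subsetP=> p; rewrite !inE => /deg_gt0[q /H[]].
exists w; rewrite !inE //; apply/negP => /deg_gt0[q /H[]]; by rewrite eqxx.
Qed.

Lemma card_gt2_ex (A : {set T}) a b : 2 < #|A| -> exists c, [/\ c \in A, c != a & c != b].
Proof.
move=> h; have /card_gt0P[c] : 0 < #|A :\ a :\ b|.
  move: h; rewrite (cardsD1 a) (cardsD1 b (A :\ a)).
  by case: (a \in A) (b \in A :\ a) #|(_ :\ _) :\ _| => [] [] [].
by rewrite !inE => /and3P[? ? ?]; exists c.
Qed.

Lemma card_gt1_ex (A : {set T}) a : 1 < #|A| -> exists c, c \in A /\ c != a.
Proof.
move=> h; have /card_gt0P[c] : 0 < #|A :\ a|.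
  by move: h; rewrite (cardsD1 a); case: (a \in A) #|_ :\ _| => [] [].
by rewrite !inE => /andP[? ?]; exists c.
Qed.

Lemma set3_of_card3 (A : {set T}) a b : a \in A -> b \in A -> a != b -> #|A| = 3 ->
  exists c, [/\ c != a, c != b & A = [set a; b; c]].
Proof.
move=> aA bA ab A3; have [c [cA ca cb]] : exists c, [/\ c \in A, c != a & c != b].
  by apply: card_gt2_ex; rewrite A3.
exists c; split=> //; apply/eqP; rewrite eq_sym eqEcard A3 -setUA.
rewrite !cardsU1 cards1 !inE (negPf ab) eq_sym (negPf ca) eq_sym (negPf cb) andbT.
by apply/subsetP=> d; rewrite !inE => /or3P[]/eqP->.
Qed.

Lemma set2_of_card2 (A : {set T}) a b : a \in A -> b \in A -> a != b -> #|A| <= 2 ->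
  A = [set a; b].
Proof.
move=> aA bA ab A2; apply/eqP; rewrite eq_sym eqEcard cards2 ab A2 andbT.
by apply/subsetP=> d; rewrite !inE => /orP[]/eqP->.
Qed.

End Graph.

Lemma K4_minor_of_K4 (T : finType) (e : rel T) a b c d : simple_graph e ->
  e a b -> e a c -> e a d -> e b c -> e b d -> e c d -> has_K4_minor e.
Proof.
move=> [sym irr] ab ac ad bc bd cd.
pose s := [:: a; b; c; d]; pose f (i : 'I_4) := nth a s i.
have ef i j : i != j -> e (f i) (f j).
  case: i => [[|[|[|[|i]]]] i4] //; case: j => [[|[|[|[|j]]]] j4] //= _;
    by rewrite /f /= ?ab ?ac ?ad ?bc ?bd ?cd // sym.
exists (fun i => [set f i]); split=> [i|i j ij].
  split; first by apply/set0Pn; exists (f i); rewrite inE.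
  by move=> p q /set1P-> /set1P->; apply: connect0.
split; last by exists (f i), (f j); rewrite !inE !eqxx ef.
by rewrite disjoints1 inE; apply: contraTneq (ef _ _ ij) => ->; rewrite irr.
Qed.

Lemma eq_set3_of_card3 (T : finType) (A : {set T}) a b c :
  a \in A -> b \in A -> c \in A -> a != b -> a != c -> b != c -> #|A| = 3 ->
  A = [set a; b; c].
Proof.
move=> aA bA cA ab ac bc A3; have [d [_ _ E]] := set3_of_card3 aA bA ab A3.
move: cA; rewrite E !inE ![c == _]eq_sym (negPf ac) (negPf bc) /=.
by rewrite eq_sym => /eqP->.
Qed.

(** * A vertex of degree at most 2 outside a given edge *)

(* A minimal counterexample: the hypotheses [IH] and [deg3] are refuted by
   [no_internal_vertex]. *)
Section LowVertex.
Variables (T : finType) (e : rel T) (u v : T).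
Hypotheses (sg : simple_graph e) (K4f : ~ has_K4_minor e) (uv : e u v).
Hypothesis IH : forall e' : rel T, simple_graph e' -> ~ has_K4_minor e' ->
  #|nonisolated e'| < #|nonisolated e| -> e' u v ->
  forall c, c != u -> c != v -> 0 < deg e' c ->
  exists d, [/\ d != u, d != v & 0 < deg e' d <= 2].
Hypothesis deg3 : forall d, d != u -> d != v -> 0 < deg e d -> 2 < deg e d.

Let sym := sg.1.
Let irr := sg.2.

Let neq a b : e a b -> a != b.
Proof. by apply: contraTneq => ->; rewrite irr. Qed.

(* Otherwise contracting [x y] gives a smaller counterexample. *)
Lemma contraction_obstacle x y : e x y -> y != u -> y != v ->
  (exists c, [/\ c != u, c != v, e x c, e y c & deg e c = 3]) \/
  [/\ x != u, x != v & #|(nb e x :|: nb e y) :\ x :\ y| <= 2].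
Proof.
move=> xy yu yv; have eyx : e y x by rewrite sym.
have y3 := deg3 yu yv (deg_pos eyx).
have [d [du dv /andP[d0 d2]]] :
    exists d, [/\ d != u, d != v & 0 < deg (contract e x y) d <= 2].
  (* [IH] asks for a non-isolated vertex outside [uv]: a third neighbour of [y] serves. If it is [x]
     itself, another neighbour of [y] keeps it non-isolated. *)
  have [c [cu cv c0]] : exists c, [/\ c != u, c != v & 0 < deg (contract e x y) c].
    have [c [cy cu cv]] := card_gt2_ex u v y3; rewrite in_nb in cy.
    have xney := neq xy; have cney : c != y by rewrite eq_sym neq.
    exists c; split=> //; have [xc|cx] := eqVneq x c.
      have [c' [c'y c'u]] := card_gt1_ex x (ltnW y3); rewrite in_nb in c'y.
      apply: (@deg_pos _ _ c'); rewrite -xc /contract xney eqxx c'y /= orbT andbT.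
      by rewrite [c' == y]eq_sym neq //= eq_sym.
    apply: (@deg_pos _ _ x); rewrite /contract xney eqxx cy /= !orbT andbT cney.
    by rewrite eq_sym.
  apply: (IH _ _ _ _ cu cv c0); first exact: simple_contract.
  - by move/(contract_K4_minor sym xy).
  - apply: (card_nonisolated_lt (w := y)); first exact: ltnW (ltnW y3).
    move=> p q /and4P[py _ _ /or3P[epq|/andP[/eqP-> _]|/andP[_]]].
    + by rewrite (deg_pos epq).
    + by rewrite (deg_pos xy) neq.
    + by rewrite sym => /deg_pos.
  - by rewrite /contract uv [u == y]eq_sym [v == y]eq_sym yu yv neq.
have dy : d != y by apply: contraTneq d0 => ->; rewrite deg_contract0.
have [dx|dx] := eqVneq d x.
  right; rewrite -{1 2}dx; split=> //.
  by rewrite -(nb_contract irr xy) -[#|_|]/(deg _ x) -[X in deg _ X]dx.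
(* Here [d] is not the merged vertex, and its degree fell from at least 3 to at most 2; only a
   common neighbour of [x] and [y] loses anything, and it loses 1. *)
left; exists d; have := deg_contract sg xy dx dy.
have : 2 < deg e d.
  by apply: deg3 => //; rewrite (deg_contract sg xy dx dy) addn_gt0 d0.
case: (boolP (e d x && e d y)) => [/andP[edx edy]|_] d3 E; last first.
  by rewrite E addn0 ltnNge d2 in d3.
split=> //; rewrite 1?sym //; apply/eqP; rewrite eqn_leq d3 E andbT.
by rewrite addn1 ltnS.
Qed.

(** If [p] had degree 3, its third neighbour [s] would share no neighbour with it, so only a merged
    vertex of degree 2 could obstruct the contraction of [sp]. Its neighbours would be [x] and [y],
    which are not adjacent to [s], and [s] would be left with the single neighbour [p]. *)
Lemma twin_deg_gt3 x y p q : x != u -> x != v -> y != u -> y != v -> x != y ->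
  nb e x = [set y; p; q] -> nb e y = [set x; p; q] ->
  ~~ e p q -> p != q -> p != u -> p != v -> 3 < deg e p.
Proof.
move=> xu xv yu yv xy nx ny npq pq pu pv.
have ex w : e x w = (w == y) || (w == p) || (w == q) by rewrite -in_nb nx !inE.
have ey w : e y w = (w == x) || (w == p) || (w == q) by rewrite -in_nb ny !inE.
have epx : e p x by rewrite sym ex eqxx orbT.
have epy : e p y by rewrite sym ey eqxx orbT.
have p3 := deg3 pu pv (deg_pos epx).
rewrite ltn_neqAle p3 andbT; apply/eqP => /esym p3'.
have [s [sx sy np]] : exists c, [/\ c != x, c != y & nb e p = [set x; y; c]].
  by apply: set3_of_card3; rewrite ?in_nb.
have eps : e p s by rewrite -in_nb np !inE eqxx !orbT.
have sp : s != p by rewrite eq_sym neq.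
have sq : s != q by apply: contraTneq eps => ->.
have exs : e x s = false by rewrite ex (negPf sy) (negPf sp) (negPf sq).
have eys : e y s = false by rewrite ey (negPf sx) (negPf sp) (negPf sq).
have esp : e s p by rewrite sym.
case: (contraction_obstacle esp pu pv) => [[c [_ _ esc epc _]]|[su sv le2]].
  move: epc esc; rewrite -in_nb np !inE -orbA => /or3P[]/eqP->; rewrite 1?sym ?exs ?eys ?irr //.
have := set2_of_card2 (a := x) (b := y) _ _ xy le2.
rewrite !inE epx epy !orbT ![_ == s]eq_sym sx sy /= !(eq_sym _ p) !neq // => /(_ isT isT) E.
have [t [ts tp]] := card_gt1_ex p (ltnW (deg3 su sv (deg_pos esp))).
rewrite in_nb in ts; have : t \in [set x; y] by rewrite -E !inE ts tp eq_sym neq.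
by rewrite !inE => /orP[]/eqP tE; rewrite tE sym ?exs ?eys in ts.
Qed.

(* Delete [x], then suppress [y]: by [twin_deg_gt3] the degrees of [p] and [q], which
   drop by one, remain at least 3. *)
Lemma no_twins x y p q : x != u -> x != v -> y != u -> y != v -> x != y ->
  p != q -> nb e x = [set y; p; q] -> nb e y = [set x; p; q] -> False.
Proof.
move=> xu xv yu yv xy pq nx ny.
have ex w : e x w = (w == y) || (w == p) || (w == q) by rewrite -in_nb nx !inE.
have ey w : e y w = (w == x) || (w == p) || (w == q) by rewrite -in_nb ny !inE.
have exy : e x y by rewrite ex eqxx.
have exp : e x p by rewrite ex eqxx orbT.
have exq : e x q by rewrite ex eqxx orbT.
have eyp : e y p by rewrite ey eqxx orbT.
have eyq : e y q by rewrite ey eqxx orbT.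
case: (boolP (e p q)) => epq; first exact/K4f/(K4_minor_of_K4 sg exy exp exq).
have p3 := twin_deg_gt3 xu xv yu yv xy nx ny epq pq.
have q3 : q != u -> q != v -> 3 < deg e q.
  have [nx' ny'] : nb e x = [set y; q; p] /\ nb e y = [set x; q; p].
    by rewrite nx ny setUAC; split=> //; rewrite setUAC.
  by apply: (twin_deg_gt3 xu xv yu yv xy nx' ny'); rewrite 1?sym 1?eq_sym.
pose e1 := del_vertex e x; pose e2 := suppress e1 y p q.
have sg1 : simple_graph e1 by apply: simple_del_vertex.
have sg2 : simple_graph e2 by apply: simple_suppress.
have px : p != x by rewrite eq_sym neq.
have qx : q != x by rewrite eq_sym neq.
have py : p != y by rewrite eq_sym neq.
have qy : q != y by rewrite eq_sym neq.
have e1yp : e1 y p by rewrite /e1 /del_vertex eyp px eq_sym xy.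
have e1yq : e1 y q by rewrite /e1 /del_vertex eyq qx eq_sym xy.
have n1 : nb e1 y = [set p; q].
  apply/setP=> w; rewrite in_nb /e1 /del_vertex ey !inE eq_sym xy /=.
  have [->|//] := eqVneq w x; by rewrite ![x == _]eq_sym (negPf px) (negPf qx).
have n1pq : ~~ e1 p q by apply: contra epq; apply: sub_del_vertex.
have K42 : ~ has_K4_minor e2.
  by move/(suppress_K4_minor sg1 e1yp e1yq pq)/del_vertex_K4_minor.
have e2pq : e2 p q by rewrite /e2 /suppress py qy !eqxx orbT.
have lt : #|nonisolated e2| < #|nonisolated e|.
  apply: (card_nonisolated_lt (w := x)); first exact: deg_pos exy.
  move=> a b /and3P[_ _ /or3P[/and3P[ax _ /deg_pos//]|/andP[/eqP-> _]|/andP[/eqP-> _]]].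
    by split=> //; apply: (@deg_pos _ _ x); rewrite sym.
  by split=> //; apply: (@deg_pos _ _ x); rewrite sym.
have e2uv : e2 u v.
  by rewrite /e2 /suppress /e1 /del_vertex uv ![u == _]eq_sym ![v == _]eq_sym xu yu xv yv.
have d2 d : d != y -> d != x -> deg e d = e d x + deg e2 d.
  by move=> dy dx; rewrite (deg_del_vertex e dx) -(deg_suppress sg1 n1 n1pq pq dy).
(* Since [uv] is an edge and [pq] is not, [p] or [q] lies outside [uv]; the new edge [pq] makes it
   non-isolated in [e2]. *)
have [w [wu wv]] : exists w, [/\ w != u, w != v & (w == p) || (w == q)].
  have [pu|pu] := eqVneq p u; last have [pv|pv] := eqVneq p v.
  - exists q; rewrite eqxx orbT -pu eq_sym; split=> //.
    by apply: contraNneq epq => ->; rewrite pu.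
  - exists q; rewrite eqxx orbT -pv [q == p]eq_sym; split=> //.
    by apply: contraNneq epq => ->; rewrite pv sym.
  - by exists p; rewrite eqxx.
move=> wpq; have w0 : 0 < deg e2 w.
  by case/orP: wpq => /eqP->; [apply: (deg_pos e2pq)|apply: (@deg_pos _ _ p); rewrite sg2.1].
have [d [du dv /andP[d0 dle]]] := IH sg2 K42 lt e2uv wu wv w0.
have dy : d != y by apply: contraTneq d0 => ->; rewrite deg_suppress0.
have dx : d != x.
  apply: contraTneq d0 => ->; rewrite -eqn0Ngt; apply/eqP.
  apply: eq_card0 => a; rewrite !inE /e2 /suppress /e1 /del_vertex eqxx ![x == _]eq_sym.
  by rewrite (negPf px) (negPf qx) /= !andbF.
have dE := d2 d dy dx.
have d3 : 2 < deg e d by apply: deg3; rewrite // dE addn_gt0 d0 orbT.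
have: 2 < deg e2 d; last by rewrite ltnNge dle.
move: dE; rewrite sym ex (negPf dy) /=.
have [dp|_] := eqVneq d p; first by rewrite dp in du dv *; have := p3 du dv => + E; rewrite E.
have [dq|_] := eqVneq d q; first by rewrite dq in du dv *; have := q3 du dv => + E; rewrite E.
by rewrite add0n => <-.
Qed.

(** In the other case of [contraction_obstacle], [x] and [y] each have at least two further
    neighbours and at most two in all, so they are the twins excluded by [no_twins]. *)
Lemma common_neighbour_deg3 x y : e x y -> y != u -> y != v ->
  exists c, [/\ c != u, c != v, e x c, e y c & deg e c = 3].
Proof.
move=> xy yu yv; case: (contraction_obstacle xy yu yv) => // -[xu xv le2].
have yx : e y x by rewrite sym.
have xney := neq xy.
set S := _ :\ x :\ y in le2.
have sx : nb e x :\ y \subset S.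
  by apply/subsetP=> a; rewrite !inE => /andP[-> xa]; rewrite xa eq_sym neq.
have sy : nb e y :\ x \subset S.
  by apply/subsetP=> a; rewrite !inE => /andP[-> ya]; rewrite ya orbT eq_sym neq.
have x3 := deg3 xu xv (deg_pos xy); have y3 := deg3 yu yv (deg_pos yx).
have cx : #|nb e x :\ y| = (deg e x).-1 by rewrite /deg (cardsD1 y (nb e x)) in_nb xy.
have cy : #|nb e y :\ x| = (deg e y).-1 by rewrite /deg (cardsD1 x (nb e y)) in_nb yx.
have Ex : nb e x :\ y = S.
  apply/eqP; rewrite eqEcard sx (leq_trans le2) // cx.
  by case: (deg e x) x3.
have Ey : nb e y :\ x = S.
  apply/eqP; rewrite eqEcard sy (leq_trans le2) // cy.
  by case: (deg e y) y3.
have /cards2P[p [q [pq SE]]] : #|S| == 2.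
  by rewrite eqn_leq le2 -Ex cx; case: (deg e x) x3.
case: (no_twins xu xv yu yv xney pq); rewrite -setUA -SE.
  by rewrite -Ex setD1K ?in_nb.
by rewrite -Ey setD1K ?in_nb.
Qed.

(** Repeated use of [common_neighbour_deg3] leads to a triangle [zxy] of vertices of degree 3
    outside [uv]. The third neighbour [t] of [z] shares a neighbour with [z], necessarily [x] or
    [y], and that vertex is then an adjacent twin of [z]. *)
Lemma no_internal_vertex c : c != u -> c != v -> 0 < deg e c -> False.
Proof.
move=> cu cv /deg_gt0[d cd]; rewrite sym in cd.
have [z [zu zv _ cz z3]] := common_neighbour_deg3 cd cu cv.
have [x [xu xv cx zx x3]] := common_neighbour_deg3 cz zu zv.
have [y [yu yv zy xy y3]] := common_neighbour_deg3 zx xu xv.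
have [t [tx ty nz]] : exists t, [/\ t != x, t != y & nb e z = [set x; y; t]].
  by apply: set3_of_card3; rewrite ?in_nb // neq.
have zt : e z t by rewrite -in_nb nz !inE eqxx !orbT.
have tz : e t z by rewrite sym.
have [r [ru rv tr zr _]] := common_neighbour_deg3 tz zu zv.
have: r \in nb e z by rewrite in_nb.
have zx' := neq zx; have zy' := neq zy; have zt' := neq zt; have xy' := neq xy.
rewrite nz !inE -orbA => /or3P[]/eqP rE; rewrite rE in tr; last by rewrite irr in tr.
  apply: (no_twins zu zv xu xv zx' (p := y) (q := t)); rewrite 1?eq_sym //.
  by apply: eq_set3_of_card3; rewrite ?in_nb // 1?sym // eq_sym.
apply: (no_twins zu zv yu yv zy' (p := x) (q := t)); rewrite 1?eq_sym //.
  by rewrite nz [[set x; y]]setUC.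
by apply: eq_set3_of_card3; rewrite ?in_nb // 1?sym // eq_sym.
Qed.

End LowVertex.

Theorem low_vertex_outside_edge (T : finType) (e : rel T) u v c :
  simple_graph e -> ~ has_K4_minor e -> e u v ->
  c != u -> c != v -> 0 < deg e c ->
  exists d, [/\ d != u, d != v & 0 < deg e d <= 2].
Proof.
move: {2}#|nonisolated e|.+1 (ltnSn #|nonisolated e|) => n.
elim: n e c => // n IHn e c; rewrite ltnS => le sg K4f uv cu cv c0.
have [d /and3P[du dv dd]|H] := pickP [pred d | [&& d != u, d != v & 0 < deg e d <= 2]].
  by exists d.
exfalso; apply: (no_internal_vertex sg K4f uv _ _ cu cv c0).
  by move=> e' sg' K4' lt uv' c'; apply: IHn => //; apply: leq_trans le.
by move=> d du dv d0; move: (H d); rewrite /= du dv d0 /= ltnNge => ->.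
Qed.

(** * At most three vertices of degree 2 *)

Section K23.
(** [L] stands for the set of [x], [y] and [z]; the two degree conditions describe a graph from
    which no vertex can be removed as a source or a sink. *)
Variables (T : finType) (e : rel T) (L : {set T}).
Hypotheses (sg : simple_graph e) (tf : triangle_free e) (K4f : ~ has_K4_minor e).
Hypothesis (L3 : #|L| = 3).
Hypothesis degN1 : forall v, deg e v != 1.
Hypothesis degN2 : forall v, v \notin L -> deg e v != 2.

Let sym := sg.1.
Let irr := sg.2.

Let neq a b : e a b -> a != b.
Proof. by apply: contraTneq => ->; rewrite irr. Qed.

Let low_deg v : 0 < deg e v <= 2 -> deg e v = 2.
Proof. by case/andP; have := degN1 v; case: (deg e v) => [|[|[|]]]. Qed.

Let low_in v : 0 < deg e v <= 2 -> v \in L.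
Proof. by move/low_deg=> d2; apply: contraT => /degN2; rewrite d2. Qed.

Let nonadj w a b : nb e w = [set a; b] -> ~~ e a b.
Proof.
move=> nw; apply/negP => ab; apply: (tf (x := w) (y := a) (z := b)).
by split=> //; rewrite -in_nb nw !inE eqxx ?orbT.
Qed.

(** Suppressing [w1] and deleting [w2] yields the edge [ab] and keeps the degrees of all remaining
    vertices outside it, so a vertex of degree 2 found outside [ab] must be the third element [w3]
    of [L]. Once [w3] is removed too, [low_vertex_outside_edge] forbids any non-isolated vertex
    outside [ab]. *)
Lemma K23_of_twins w1 w2 a b : w1 \in L -> w2 \in L -> w1 != w2 -> a != b ->
  nb e w1 = [set a; b] -> nb e w2 = [set a; b] ->
  (forall w, w \in L -> nb e w = [set a; b]) /\
  (forall p q, e p q -> (p \in [set a; b]) && (q \in L) || (q \in [set a; b]) && (p \in L)).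
Proof.
move=> w1L w2L w12 ab n1 n2.
have [w3 [w31 w32 LE]] := set3_of_card3 w1L w2L w12 L3.
have E1 u : e w1 u = (u == a) || (u == b) by rewrite -in_nb n1 !inE.
have E2 u : e w2 u = (u == a) || (u == b) by rewrite -in_nb n2 !inE.
have nab := nonadj n1.
have [e1a e1b e2a e2b] : [/\ e w1 a, e w1 b, e w2 a & e w2 b].
  by rewrite !E1 !E2 !eqxx !orbT.
have := (neq e1a, neq e1b, neq e2a, neq e2b).
rewrite ![w1 == _]eq_sym ![w2 == _]eq_sym => -[[[aw1 bw1] aw2] bw2].
pose f1 := suppress e w1 a b; pose f2 := del_vertex f1 w2.
have sf1 : simple_graph f1 by apply: simple_suppress.
have sf2 : simple_graph f2 by apply: simple_del_vertex.
have Kf2 : ~ has_K4_minor f2 by move/del_vertex_K4_minor/(suppress_K4_minor sg e1a e1b ab).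
have f2ab : f2 a b by rewrite /f2 /f1 /del_vertex /suppress aw1 aw2 bw1 bw2 !eqxx orbT.
have f2E p q : p != a -> p != b -> p != w1 -> p != w2 -> f2 p q = e p q.
  move=> pa pb p1 p2; rewrite /f2 /f1 /del_vertex /suppress p1 p2 (negPf pa) (negPf pb) /= orbF.
  have [->|_] := eqVneq q w1; first by rewrite sym E1 (negPf pa) (negPf pb) andbF.
  by have [->|//] := eqVneq q w2; rewrite sym E2 (negPf pa) (negPf pb).
have f2w1 q : f2 w1 q = false by rewrite /f2 /f1 /del_vertex /suppress eqxx /= !andbF.
have f2w2 q : f2 w2 q = false by rewrite /f2 /f1 /del_vertex /suppress eqxx.
have pos_neq d : 0 < deg f2 d -> d != w1 /\ d != w2.
  by case/deg_gt0=> u f; split; apply: contraTneq f => ->; rewrite ?f2w1 ?f2w2.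
have f2d d : d != a -> d != b -> 0 < deg f2 d -> deg f2 d = deg e d.
  move=> da db /pos_neq[d1 d2]; congr #|pred_of_set _|.
  by apply/setP=> u; rewrite !inE f2E.
have inL d : d != a -> d != b -> 0 < deg f2 d <= 2 -> d = w3.
  move=> da db d02; have /andP[d0 _] := d02; have [d1 d2] := pos_neq d d0.
  move: d02; rewrite f2d // => /low_in.
  by rewrite LE !inE (negPf d1) (negPf d2) => /eqP.
(* One of [a] and [b] differs from [w3], hence is outside [L] and has degree at least 3; its
   neighbour other than [w1] and [w2] is still non-isolated in [f2]. *)
have big c : (c == a) || (c == b) -> c != w3 -> exists c', [/\ c' != a, c' != b & 0 < deg f2 c'].
  move=> cab c3.
  have [c1 c2] : c != w1 /\ c != w2 by case/orP: cab => /eqP->.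
  have c'0 : 0 < deg e c by apply: (@deg_pos _ _ w1); rewrite sym E1.
  have : 2 < deg e c.
    rewrite ltnNge; apply/negP => c'2; have := @low_in c.
    by rewrite c'0 c'2 LE !inE (negPf c1) (negPf c2) (negPf c3) => /(_ isT).
  case/(card_gt2_ex w1 w2) => c' []; rewrite in_nb => cc' c'1 c'w2.
  have c'a : c' != a.
    by case/orP: cab cc' => /eqP-> cc'; [rewrite eq_sym neq|apply: contraNneq nab => <-; rewrite sym].
  have c'b : c' != b.
    by case/orP: cab cc' => /eqP-> cc'; [apply: contraNneq nab => <-|rewrite eq_sym neq].
  by exists c'; split=> //; apply: (@deg_pos _ _ c); rewrite f2E // sym.
have [c [ca cb c0]] : exists c, [/\ c != a, c != b & 0 < deg f2 c].
  have [aw3|] := eqVneq a w3; last by apply: big; rewrite eqxx.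
  by apply: (big b); rewrite ?eqxx ?orbT // -aw3 eq_sym.
have [d [da db d02]] := low_vertex_outside_edge sf2 Kf2 f2ab ca cb c0.
have dE := inL d da db d02; subst d.
have /andP[d0 _] := d02.
have /eqP/cards2P[p [q [pq n3]]] : deg e w3 = 2 by apply: low_deg; rewrite -f2d.
have E3 u : e w3 u = (u == p) || (u == q) by rewrite -in_nb n3 !inE.
have [pw3 qw3] : p != w3 /\ q != w3.
  by split; rewrite eq_sym neq // E3 eqxx ?orbT.
have npq := nonadj n3.
case: (boolP ([set p; q] == [set a; b])) => [/eqP pqab|npqab]; last first.
  (* If [w3] is not a third twin, suppressing it keeps [p] and [q] non-isolated, one of them outside
     [ab], although [L] is exhausted. *)
  exfalso; pose f3 := suppress f2 w3 p q.
  have n3' : nb f2 w3 = [set p; q] by rewrite -n3; apply/setP=> u; rewrite !inE f2E.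
  have [f2p f2q] : f2 w3 p /\ f2 w3 q by rewrite -!in_nb n3' !inE !eqxx orbT.
  have f2pq : ~~ f2 p q.
    apply: contra npqab => /and3P[_ _ /and3P[_ _ /or3P[|/andP[/eqP-> /eqP->]//|/andP[/eqP-> /eqP->]]]].
      by rewrite (negPf npq).
    by rewrite setUC.
  have sf3 : simple_graph f3 by apply: simple_suppress.
  have Kf3 : ~ has_K4_minor f3 by move/(suppress_K4_minor sf2 f2p f2q pq).
  have f3ab : f3 a b by rewrite /f3 /suppress f2ab ![_ == w3]eq_sym da db.
  have f3pq : f3 p q by rewrite /f3 /suppress pw3 qw3 !eqxx !orbT.
  have [c' [c'a c'b c'0]] : exists c, [/\ c != a, c != b & 0 < deg f3 c].
    have [pa|pa] := eqVneq p a; last have [pb|pb] := eqVneq p b.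
    - exists q; split; [by rewrite -pa eq_sym| |by apply: (@deg_pos _ _ p); rewrite sf3.1].
      by apply: contraNneq npqab => ->; rewrite pa.
    - exists q; split; [|by rewrite -pb eq_sym|by apply: (@deg_pos _ _ p); rewrite sf3.1].
      by apply: contraNneq npqab => ->; rewrite pb setUC.
    - by exists p; split=> //; apply: deg_pos f3pq.
  have [d [d'a d'b]] := low_vertex_outside_edge sf3 Kf3 f3ab c'a c'b c'0.
  have [->|d3] := eqVneq d w3; first by rewrite deg_suppress0.
  by rewrite deg_suppress // => /(inL d d'a d'b) E; rewrite E eqxx in d3.
split=> [w|p' q' epq].
  by rewrite LE !inE -orbA => /or3P[]/eqP-> //; rewrite n3.
have f3z c' : c' != a -> c' != b -> 0 < deg (del_vertex f2 w3) c' -> False.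
  move=> c'a c'b c'0.
  have f3ab : del_vertex f2 w3 a b by rewrite /del_vertex ![_ == w3]eq_sym da db f2ab.
  have Kf3 : ~ has_K4_minor (del_vertex f2 w3) by move/del_vertex_K4_minor.
  have [d [d'a d'b]] := low_vertex_outside_edge (simple_del_vertex w3 sf2) Kf3 f3ab c'a c'b c'0.
  have [->|d3] := eqVneq d w3; first by rewrite deg_del_vertex0.
  have -> : deg (del_vertex f2 w3) d = deg f2 d.
    rewrite (deg_del_vertex f2 d3) sf2.1 f2E // E3.
    by have := in_set2 d p q; rewrite pqab !inE (negPf d'a) (negPf d'b) => <-.
  by move/(inL d d'a d'b) => E; rewrite E eqxx in d3.
have LN w u : w \in L -> e w u -> u \in [set a; b].
  by rewrite LE !inE -orbA => /or3P[]/eqP->; rewrite ?E1 ?E2 // E3 -in_set2 pqab !inE.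
case: (boolP (p' \in L)) => [p'L|p'L]; first by rewrite (LN _ _ p'L epq) ?orbT.
case: (boolP (q' \in L)) => [q'L|q'L]; first by rewrite (LN q') // sym.
move: p'L q'L; rewrite LE !inE !negb_or -!andbA => /and3P[p1 p2 p3] /and3P[q1 q2 q3].
(* An edge avoiding [L] survives the removals, so both its ends are among [a] and [b], which are not
   adjacent in [e]. *)
have core p'' q'' : e p'' q'' -> p'' != w1 -> p'' != w2 -> p'' != w3 -> q'' != w3 ->
    (p'' == a) || (p'' == b).
  move=> epq' ? ? ? ?; apply: contraT; rewrite negb_or => /andP[pa pb]; case: (f3z p'') => //.
  by apply: (@deg_pos _ _ q''); rewrite /del_vertex f2E //; apply/and3P.
exfalso; have eqp : e q' p' by rewrite sym.
case/orP: (core p' q' epq p1 p2 p3 q3) => /eqP pE; case/orP: (core q' p' eqp q1 q2 q3 p3) => /eqP qE;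
  by move: epq nab; rewrite pE qE ?irr // 1?sym => ->.
Qed.

Theorem K23_of_three_low p0 q0 : e p0 q0 ->
  exists a b, [/\ a != b, forall w, w \in L -> nb e w = [set a; b] &
    forall p q, e p q -> (p \in [set a; b]) && (q \in L) || (q \in [set a; b]) && (p \in L)].
Proof.
move=> e00.
have twins w1 w2 a b : w1 \in L -> w2 \in L -> w1 != w2 -> a != b ->
    nb e w1 = [set a; b] -> nb e w2 = [set a; b] -> 
    exists a b, [/\ a != b, forall w, w \in L -> nb e w = [set a; b] &
    forall p q, e p q -> (p \in [set a; b]) && (q \in L) || (q \in [set a; b]) && (p \in L)].
  move=> w1L w2L w12 ab n1 n2; exists a, b.
  by have [] := K23_of_twins w1L w2L w12 ab n1 n2.
have deg2 p q : e p q -> 1 < deg e p.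
  by move/deg_pos; have := degN1 p; case: (deg e p) => [|[]].
have [c [c0 cq]] := card_gt1_ex q0 (deg2 _ _ e00); rewrite in_nb in c0.
have cp : c != p0 by rewrite eq_sym neq.
have c'0 : 0 < deg e c by apply: (@deg_pos _ _ p0); rewrite sym.
have [w1 [_ _ low1]] := low_vertex_outside_edge sg K4f e00 cp cq c'0.
have w1L := low_in low1.
have /eqP/cards2P[a [b [ab n1]]] := low_deg low1.
have nab := nonadj n1.
have [w1a w1b] : e w1 a /\ e w1 b by rewrite -!in_nb n1 !inE !eqxx orbT.
have aw1 : a != w1 by rewrite eq_sym neq.
have bw1 : b != w1 by rewrite eq_sym neq.
pose e1 := suppress e w1 a b.
have sg1 : simple_graph e1 by apply: simple_suppress.
have K1 : ~ has_K4_minor e1 by move/(suppress_K4_minor sg w1a w1b ab).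
have e1ab : e1 a b by rewrite /e1 /suppress aw1 bw1 !eqxx orbT.
have d1 v : v != w1 -> deg e1 v = deg e v by apply: deg_suppress.
have [c1 [c1a c1b]] : exists c, c \in nb e1 a /\ c != b.
  by apply: card_gt1_ex; rewrite -/(deg e1 a) d1 // (@deg2 a w1) // sym.
rewrite in_nb in c1a; have c1a' : c1 != a by apply: contraTneq c1a => ->; rewrite sg1.2.
have c10 : 0 < deg e1 c1 by apply: (@deg_pos _ _ a); rewrite sg1.1.
have [w2 [w2a w2b low2]] := low_vertex_outside_edge sg1 K1 e1ab c1a' c1b c10.
have w21 : w2 != w1 by apply: contraTneq low2 => ->; rewrite deg_suppress0.
rewrite d1 // in low2.
have w2L := low_in low2.
have /eqP/cards2P[c2 [d2 [cd n2]]] := low_deg low2.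
have ncd := nonadj n2.
case: (boolP ([set c2; d2] == [set a; b])) => [/eqP E|ncdab].
  by apply: (twins w2 w1 a b); rewrite // n2.
have n2' : nb e1 w2 = [set c2; d2].
  rewrite -n2; apply/setP=> u; rewrite !inE /e1 /suppress w21 (negPf w2a) (negPf w2b) /= orbF.
  have [->|//] := eqVneq u w1; by rewrite sym -(in_nb e) n1 !inE (negPf w2a) (negPf w2b).
(* Suppression makes only one new pair adjacent. By triangle-freeness the two neighbours of a vertex
   of degree 2 are not adjacent in [e], so they stay so unless that vertex has a twin suppressed
   before it. *)
have nsup (f : rel T) w p q x y : ~~ f x y -> [set x; y] != [set p; q] -> ~~ suppress f w p q x y.
  move=> nf npq; apply: contra npq => /and3P[_ _ /or3P[|/andP[/eqP-> /eqP->]//|/andP[/eqP-> /eqP->]]].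
    by rewrite (negPf nf).
  by rewrite setUC.
have n1cd : ~~ e1 c2 d2 by apply: nsup.
have [w2c w2d] : e1 w2 c2 /\ e1 w2 d2 by rewrite -!in_nb n2' !inE !eqxx orbT.
pose e2 := suppress e1 w2 c2 d2.
have sg2 : simple_graph e2 by apply: simple_suppress.
have K2 : ~ has_K4_minor e2 by move/(suppress_K4_minor sg1 w2c w2d cd).
have cw2 : c2 != w2 by apply: contraTneq w2c => ->; rewrite sg1.2.
have dw2 : d2 != w2 by apply: contraTneq w2d => ->; rewrite sg1.2.
have e2cd : e2 c2 d2 by rewrite /e2 /suppress cw2 dw2 !eqxx orbT.
have e2ab : e2 a b by rewrite /e2 /suppress e1ab ![_ == w2]eq_sym w2a w2b.
have iso d : 0 < deg e2 d -> d != w1 /\ d != w2.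
  move=> d0; have d2' : d != w2 by apply: contraTneq d0 => ->; rewrite deg_suppress0.
  by split=> //; apply: contraTneq d0 => d'; rewrite deg_suppress // d' deg_suppress0.
have dg2 d : d != w1 -> d != w2 -> deg e2 d = deg e d.
  by move=> *; rewrite deg_suppress // deg_suppress.
have w12 : w1 != w2 by rewrite eq_sym.
have [w3 [w31 w32 LE]] := set3_of_card3 w1L w2L w12 L3.
have inL2 d : 0 < deg e2 d <= 2 -> d = w3.
  move=> d02; have /andP[d0 _] := d02; have [dw1' dw2'] := iso d d0.
  move: d02; rewrite dg2 // => /low_in.
  by rewrite LE !inE (negPf dw1') (negPf dw2') => /eqP.
have pos1 d : 0 < deg e2 d -> 1 < deg e2 d.
  move=> d0; have [dw1' dw2'] := iso d d0; move: d0; rewrite dg2 //.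
  by have := degN1 d; case: (deg e d) => [|[]].
have far (f : rel T) p q : simple_graph f -> f p q -> 1 < deg f p ->
    exists x, [/\ x != p, x != q & 0 < deg f x].
  move=> sf fpq /(card_gt1_ex q)[r []]; rewrite in_nb => fpr rq; exists r; split=> //.
    by apply: contraTneq fpr => ->; rewrite sf.2.
  by apply: (@deg_pos _ _ p); rewrite sf.1.
have [r [rc rd r0]] := far _ _ _ sg2 e2cd (pos1 _ (deg_pos e2cd)).
have [w [wc wd low3]] := low_vertex_outside_edge sg2 K2 e2cd rc rd r0.
have wE := inL2 w low3; subst w.
(* A second application, now to [ab], again finds [w3]. Being outside both new edges, [w3] has the
   same neighbours in [e2] as in [e]. *)
have [s [sa sb s0]] := far _ _ _ sg2 e2ab (pos1 _ (deg_pos e2ab)).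
have [w [wa wb low3']] := low_vertex_outside_edge sg2 K2 e2ab sa sb s0.
have wE := inL2 w low3'; subst w.
have w3L : w3 \in L by rewrite LE !inE eqxx !orbT.
have := low3; rewrite dg2 // => /low_deg/eqP/cards2P[p [q [pq n3]]].
have npq := nonadj n3.
case: (boolP ([set p; q] == [set a; b])) => [/eqP E|npqab].
  by apply: (twins w3 w1 a b); rewrite // n3.
case: (boolP ([set p; q] == [set c2; d2])) => [/eqP E|npqcd].
  by apply: (twins w3 w2 c2 d2); rewrite // n3.
have n3' : nb e2 w3 = [set p; q].
  rewrite -n3; apply/setP=> u; rewrite !inE /e2 /e1 /suppress w31 w32.
  rewrite (negPf wa) (negPf wb) (negPf wc) (negPf wd) /= !orbF.
  have [->|_] := eqVneq u w1; first by rewrite sym -(in_nb e) n1 !inE (negPf wa) (negPf wb) andbF.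
  by have [->|//] := eqVneq u w2; rewrite sym -(in_nb e) n2 !inE (negPf wc) (negPf wd).
have n2pq : ~~ e2 p q by apply: (nsup) => //; apply: (nsup).
have [w3p w3q] : e2 w3 p /\ e2 w3 q by rewrite -!in_nb n3' !inE !eqxx orbT.
pose e3 := suppress e2 w3 p q.
have sg3 : simple_graph e3 by apply: simple_suppress.
have K3 : ~ has_K4_minor e3 by move/(suppress_K4_minor sg2 w3p w3q pq).
have pw3 : p != w3 by apply: contraTneq w3p => ->; rewrite sg2.2.
have qw3 : q != w3 by apply: contraTneq w3q => ->; rewrite sg2.2.
have e3pq : e3 p q by rewrite /e3 /suppress pw3 qw3 !eqxx !orbT.
have p1 : 1 < deg e3 p.
  by rewrite deg_suppress // pos1 // (@deg_pos _ _ w3) // sg2.1.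
have [t [tp tq t0]] := far _ _ _ sg3 e3pq p1.
(* This vertex would also have degree 1 or 2 in [e2], hence be [w3], which is now isolated. *)
have [d [_ _]] := low_vertex_outside_edge sg3 K3 e3pq tp tq t0.
have [->|d3] := eqVneq d w3; first by rewrite deg_suppress0.
by rewrite deg_suppress // => /inL2 E; rewrite E eqxx in d3.
Qed.
End K23.

(** * Alon-Tarsi orientations *)

Section AlonTarsi.
Variable T : finType.
Implicit Types (e : rel T) (D A F : {set T * T}) (u v : T).

Lemma eulerian_sub_no_source D F v : eulerian_sub D F ->
  (forall u, (u, v) \notin D) -> forall u, (v, u) \notin F.
Proof.
case/andP=> /subsetP FD /forallP/(_ v)/eqP oi src u.
have i0 : indeg F v = 0.
  apply: eq_card0 => -[p q]; rewrite !inE /=; apply/negP => /andP[/FD pD /eqP qv].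
  by case/negP: (src p); rewrite -qv.
by apply/negP => vu; have := card0_eq (etrans oi i0) (v, u); rewrite !inE vu eqxx.
Qed.

Lemma eulerian_sub_no_sink D F v : eulerian_sub D F ->
  (forall u, (v, u) \notin D) -> forall u, (u, v) \notin F.
Proof.
case/andP=> /subsetP FD /forallP/(_ v)/eqP oi snk u.
have o0 : outdeg F v = 0.
  apply: eq_card0 => -[p q]; rewrite !inE /=; apply/negP => /andP[/FD pD /eqP qv].
  by case/negP: (snk q); rewrite -qv.
by apply/negP => vu; have := card0_eq (etrans (esym oi) o0) (u, v); rewrite !inE vu eqxx.
Qed.

(** An arc that leaves a source or enters a sink lies in no Eulerian sub-digraph, so the two sums
    range over the same sets. *)
Lemma diffE_setU D A :
  (forall p q, (p, q) \in A ->
    (forall u, (u, p) \notin D :|: A) \/ (forall u, (q, u) \notin D :|: A)) ->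
  diffE (D :|: A) = diffE D.
Proof.
move=> H; apply: eq_bigl => F; apply/idP/idP => EF; last first.
  by case/andP: EF => FD E; rewrite /eulerian_sub E (subset_trans FD (subsetUl _ _)).
have /andP[/subsetP FD E] := EF; rewrite /eulerian_sub E andbT.
apply/subsetP=> -[p q] pqF; have := FD _ pqF; rewrite inE => /orP[//|pqA].
case: (H _ _ pqA) => [src|snk].
  by case/negP: (eulerian_sub_no_source EF src q).
by case/negP: (eulerian_sub_no_sink EF snk p).
Qed.

Lemma outdeg_setU D A v : outdeg (D :|: A) v <= outdeg D v + outdeg A v.
Proof.
rewrite /outdeg (_ : [set a in D :|: A | _] = [set a in D | a.1 == v] :|: [set a in A | a.1 == v]).
  by rewrite cardsU leq_subr.
by apply/setP=> a; rewrite !inE andb_orl.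
Qed.

(** All edges at [v] are directed away from it: its out-degree is its degree, and no other
    out-degree changes. *)
Lemma f_AT_source e v (f : T -> nat) : simple_graph e ->
  f_AT (del_vertex e v) f -> deg e v < f v -> f_AT e f.
Proof.
move=> [sym irr] [D [[or1 or2] AT od]] dv.
pose A := [set a : T * T | (a.1 == v) && e v a.2].
have inD p q : (p, q) \in D -> [/\ p != v, q != v & e p q] by move/or1/and3P.
have src u : (u, v) \notin D :|: A.
  rewrite !inE /= irr andbF orbF; apply/negP => /inD[]; by rewrite eqxx.
exists (D :|: A); split.
- split=> p q; rewrite !inE /=; first by case/orP=> [/inD[]//|/andP[/eqP->]].
  move=> epq; have [pv|pv] := eqVneq p v; last have [qv|qv] := eqVneq q v.
  + rewrite -pv epq orbT pv /= [_ && e v v]andbC irr /= orbF.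
    rewrite (_ : (q, v) \in D = false); last by apply/negP => /inD[_]; rewrite eqxx.
    by case: eqP pv epq => // -> <-; rewrite irr.
  + rewrite qv sym -qv epq /= !orbF orbT.
    by rewrite (_ : (p, q) \in D = false) //; apply/negP => /inD[_]; rewrite qv eqxx.
  + by rewrite /= !orbF; apply: or2; apply/and3P.
- rewrite /AT_orientation diffE_setU // => p q; rewrite inE /= => /andP[/eqP-> _]; by left.
move=> u; apply: leq_ltn_trans (outdeg_setU _ _ _) _.
have [->|uv] := eqVneq u v.
  have -> : outdeg D v = 0.
    apply: eq_card0 => -[p q]; rewrite !inE /=.
    by apply/negP => /andP[/inD[pv _ _]]; rewrite (negPf pv).
  apply: leq_ltn_trans dv; rewrite add0n /deg.
  rewrite -(card_imset (mem (nb e v)) (f := pair v)) => [|p q []//].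
  apply: subset_leq_card; apply/subsetP => -[p q]; rewrite !inE /= => /andP[/andP[/eqP-> eq] _].
  by apply: imset_f; rewrite inE.
have -> : outdeg A u = 0; last by rewrite addn0 od.
apply: eq_card0 => -[p q]; rewrite !inE /=; apply/negP => /andP[/andP[/eqP-> _]].
by rewrite eq_sym (negPf uv).
Qed.

(** All edges at [v] are directed towards it, which costs each neighbour one more out-arc; this is
    the summand [e u v]. *)
Lemma f_AT_sink e v (f f' : T -> nat) : simple_graph e ->
  f_AT (del_vertex e v) f' -> 0 < f v -> (forall u, u != v -> f' u + e u v <= f u) -> f_AT e f.
Proof.
move=> [sym irr] [D [[or1 or2] AT od]] fv ff'.
pose A := [set a : T * T | (a.2 == v) && e a.1 v].
have inD p q : (p, q) \in D -> [/\ p != v, q != v & e p q] by move/or1/and3P.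
have snk u : (v, u) \notin D :|: A.
  rewrite !inE /= irr andbF orbF; apply/negP => /inD[]; by rewrite eqxx.
exists (D :|: A); split.
- split=> p q; rewrite !inE /=; first by case/orP=> [/inD[]//|/andP[/eqP->]].
  move=> epq; have [qv|qv] := eqVneq q v; last have [pv|pv] := eqVneq p v.
  + rewrite -qv epq orbT /= [X in X || _](_ : _ = false) /=; last first.
      by apply/negP => /inD[]; rewrite qv eqxx.
    by rewrite (_ : p == q = false) //; apply: contraTF epq => /eqP->; rewrite irr.
  + rewrite pv sym -pv epq /= !orbF orbT.
    by rewrite (_ : (p, q) \in D = false) //; apply/negP => /inD[]; rewrite pv eqxx.
  + by rewrite /= !orbF; apply: or2; apply/and3P.
- rewrite /AT_orientation diffE_setU // => p q; rewrite inE /= => /andP[/eqP-> _]; by right.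
move=> u; apply: leq_ltn_trans (outdeg_setU _ _ _) _.
have [->|uv] := eqVneq u v.
  have -> : outdeg D v = 0.
    apply: eq_card0 => -[p q]; rewrite !inE /=.
    by apply/negP => /andP[/inD[pv _ _]]; rewrite (negPf pv).
  have -> // : outdeg A v = 0.
  apply: eq_card0 => -[p q]; rewrite !inE /=.
  by apply/negP => /andP[/andP[_ ep] /eqP E]; rewrite E irr in ep.
apply: leq_trans (ff' u uv); rewrite -addSn; apply: leq_add; first exact: od.
case euv: (e u v); last first.
  rewrite leqn0; apply/eqP; apply: eq_card0 => -[p q]; rewrite !inE /=.
  by apply/negP => /andP[/andP[_ ep] /eqP E]; rewrite E euv in ep.
rewrite /= -(cards1 (u, v)); apply: subset_leq_card; apply/subsetP => -[p q].
by rewrite !inE /= => /andP[/andP[/eqP-> _] /eqP->].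
Qed.

Lemma card_tails F (X : {set T}) :
  #|[set a in F | a.1 \in X]| = \sum_(v in X) outdeg F v.
Proof.
rewrite -sum1_card (partition_big fst (mem X)) /= => [|a]; last by rewrite inE => /andP[].
apply: eq_bigr => v vX; rewrite /outdeg /indeg -sum1_card; apply: eq_bigl => a.
by rewrite !inE -andbA; case: eqP => [->|]; rewrite ?vX ?andbF.
Qed.

Lemma card_heads F (X : {set T}) :
  #|[set a in F | a.2 \in X]| = \sum_(v in X) indeg F v.
Proof.
rewrite -sum1_card (partition_big snd (mem X)) /= => [|a]; last by rewrite inE => /andP[].
apply: eq_bigr => v vX; rewrite /outdeg /indeg -sum1_card; apply: eq_bigl => a.
by rewrite !inE -andbA; case: eqP => [->|]; rewrite ?vX ?andbF.
Qed.

(** In an Eulerian sub-digraph the arcs with tail in [X] are as many as those with head in [X], by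
    summing degrees over [X]. Every arc is of exactly one of the two kinds, so the number of arcs is
    even. *)
Lemma AT_bipartite D (X : {set T}) :
  (forall p q, (p, q) \in D -> (p \in X) != (q \in X)) -> AT_orientation D.
Proof.
move=> bip; rewrite /AT_orientation /diffE.
have even F : eulerian_sub D F -> ~~ odd #|F|.
  case/andP=> /subsetP FD /forallP oi.
  rewrite -(cardsID [set a : T * T | a.1 \in X] F).
  have -> : F :&: [set a | a.1 \in X] = [set a in F | a.1 \in X].
    by apply/setP=> a; rewrite !inE.
  have -> : F :\: [set a | a.1 \in X] = [set a in F | a.2 \in X].
    apply/setP=> -[p q]; rewrite !inE /= andbC; case pF: (_ \in F) => //=.
    by have := bip _ _ (FD _ pF); case: (p \in X) (q \in X) => [] [].
  rewrite card_tails card_heads (eq_bigr (indeg F)) => [|v _]; last exact/eqP.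
  by rewrite addnn odd_double.
rewrite (eq_bigr (fun=> 1%R)) => [|F /even eF]; last by rewrite -GRing.signr_odd (negPf eF).
(* The sum now counts the Eulerian sub-digraphs, and the empty one is among them. *)
rewrite GRing.sumr_const Num.Theory.pnatr_eq0 -lt0n; apply/card_gt0P; exists set0.
rewrite unfold_in /= /eulerian_sub sub0set /=; apply/forallP=> v; apply/eqP.
by apply: etrans (eq_card0 _) (esym (eq_card0 _)) => a; rewrite !inE.
Qed.

Lemma outdeg_setU1 a F v : outdeg (a |: F) v <= (a.1 == v) + outdeg F v.
Proof.
apply: leq_trans (outdeg_setU _ _ _) _; rewrite leq_add2r.
case av: (a.1 == v); last first.
  rewrite leqn0; apply/eqP; apply: eq_card0 => b; rewrite !inE.
  by case: eqP => [->|//]; rewrite av.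
rewrite /= -(cards1 a); apply: subset_leq_card; apply/subsetP => b.
by rewrite !inE => /andP[].
Qed.

Lemma AT_extendable_K23 e x y z a b : simple_graph e ->
  x != y -> y != z -> x != z -> a != b ->
  (forall w, w \in [set x; y; z] -> nb e w = [set a; b]) ->
  (forall p q, e p q -> (p \in [set a; b]) && (q \in [set x; y; z]) ||
                        (q \in [set a; b]) && (p \in [set x; y; z])) ->
  AT_extendable3 e 2 2 1 x y z.
Proof.
move=> [sym irr] xy yz xz ab nb3 edges.
have E w u : w \in [set x; y; z] -> u \in [set a; b] -> e w u /\ e u w.
  by move=> /nb3 wN uN; rewrite [e u w]sym; split; rewrite -in_nb wN.
have dis w u : w \in [set x; y; z] -> u \in [set a; b] -> (w == u = false) * (u == w = false).
  move=> wL uN; have [ewu _] := E w u wL uN.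
  have ne : w == u = false by apply: contraTF ewu => /eqP->; rewrite irr.
  by rewrite ne eq_sym ne.
have [xL yL zL] : [/\ x \in [set x; y; z], y \in [set x; y; z] & z \in [set x; y; z]].
  by rewrite !inE !eqxx !orbT.
have [aN bN] : a \in [set a; b] /\ b \in [set a; b] by rewrite !inE !eqxx orbT.
have yx : y != x by rewrite eq_sym.
have zy : z != y by rewrite eq_sym.
have zx : z != x by rewrite eq_sym.
have ba : b != a by rewrite eq_sym.
pose ne := (negPf xy, negPf yz, negPf xz, negPf ab, negPf yx, negPf zy, negPf zx, negPf ba,
  dis x a xL aN, dis x b xL bN, dis y a yL aN, dis y b yL bN, dis z a zL aN, dis z b zL bN).
(* The out-degrees are 0 at [z], 1 at [x] and [y], 2 at [a] and [b]: one less than [f3] at each of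
   them. *)
pose D : {set T * T} := (a, z) |: ((b, z) |: ((b, x) |: ((a, y) |: ((x, a) |: ((y, b) |: set0))))).
exists D; split.
- split=> p q.
    rewrite !inE !xpair_eqE orbF.
    have [[_ ?] [_ ?]] := (E x a xL aN, E x b xL bN).
    have [[_ ?] [_ ?]] := (E y a yL aN, E y b yL bN).
    have [[_ ?] [_ ?]] := (E z a zL aN, E z b zL bN).
    by do ![case/orP]; case/andP=> /eqP-> /eqP-> //; rewrite sym.
  move/edges; rewrite /D !inE !xpair_eqE -!orbA.
  by case/orP=> /andP[/orP[]/eqP-> /or3P[]/eqP->]; rewrite ?eqxx ?ne.
- apply: (@AT_bipartite _ [set a; b]) => p q.
  rewrite !inE !xpair_eqE orbF.
  by do ![case/orP]; case/andP=> /eqP-> /eqP->; rewrite ?eqxx ?ne.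
move=> v.
have: outdeg D v <= (a == v) + ((b == v) + ((b == v) + ((a == v) + ((x == v) + ((y == v) + 0))))).
  do 6![apply: leq_trans (outdeg_setU1 _ _ _) _; rewrite leq_add2l].
  by rewrite leqn0; apply/eqP; apply: eq_card0 => c; rewrite !inE.
move=> le; apply: leq_ltn_trans le _; rewrite /f3 ![_ == v]eq_sym.
have [->|_] := eqVneq v x; first by rewrite !ne.
have [->|_] := eqVneq v y; first by rewrite !ne.
have [->|_] := eqVneq v z; first by rewrite !ne.
by have [->|_] := eqVneq v a; rewrite ?ne //; case: eqP.
Qed.

End AlonTarsi.

(** * Induction on the number of non-isolated vertices *)

Theorem mainTheorem5 (T : finType) (e : rel T) :
  simple_graph e -> triangle_free e -> ~ has_K4_minor e ->
  forall x y z : T, x != y -> y != z -> x != z ->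
    AT_extendable3 e 2 2 1 x y z.
Proof.
move: {2}#|nonisolated e|.+1 (ltnSn #|nonisolated e|) => n.
elim: n e => // n IHn e; rewrite ltnS => le sg tf K4f x y z xy yz xz.
have sym := sg.1; have irr := sg.2.
(* The triple stays general because putting [z] back as a sink changes it. It may contain [v], which
   remains in [T] as an isolated vertex. *)
have IH v : 0 < deg e v -> forall x y z : T, x != y -> y != z -> x != z ->
    AT_extendable3 (del_vertex e v) 2 2 1 x y z.
  move=> v0; apply: IHn.
  - apply: leq_trans le; apply: (card_nonisolated_lt (w := v)) => // p q /and3P[pv _ /deg_pos d]; by [].
  - exact: simple_del_vertex.
  - by move=> p q r [/sub_del_vertex pq /sub_del_vertex qr /sub_del_vertex pr]; apply: (tf p q r).
  - by move/del_vertex_K4_minor.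
have source v : 0 < deg e v < f3 x y z 2 2 1 v -> AT_extendable3 e 2 2 1 x y z.
  by case/andP=> v0 vf; apply: (f_AT_source (v := v)) => //; apply: IH.
have [v /source//|nsrc] := pickP [pred v | 0 < deg e v < f3 x y z 2 2 1 v].
have [z1|z1] := eqVneq (deg e z) 1.
  have [u zu] : exists u, e z u by apply/deg_gt0; rewrite z1.
  have Nz w : e w z = (w == u).
    rewrite sym; apply/idP/eqP => [zw|-> //].
    by have /eqP/cards1P[t Et] := z1; move: zu zw; rewrite -!in_nb Et => /set1P-> /set1P->.
  have zneu : u != z by apply: contraTneq zu => ->; rewrite irr.
  have z0 : 0 < deg e z by rewrite z1.
  have f3z : f3 x y z 2 2 1 z = 1 by rewrite /f3 !(eq_sym z) (negPf xz) (negPf yz) eqxx.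
  (* In the smaller graph [u] gets the bound 1, so that it can afford the arc to [z]. If [u] is [x]
     or [y], the isolated [z] fills its former place in the triple. *)
  have [ux|ux] := eqVneq u x; last have [uy|uy] := eqVneq u y.
  - apply: (f_AT_sink sg (IH z z0 z y x _ _ _)); rewrite ?f3z // 1?eq_sym // => w wz.
    rewrite Nz /f3 (negPf wz) ux; have [->|_] := eqVneq w x; first by rewrite (negPf xy).
    by case: (w == y).
  - apply: (f_AT_sink sg (IH z z0 x z y _ _ _)); rewrite ?f3z // 1?eq_sym // => w wz.
    rewrite Nz /f3 (negPf wz) uy; have [->|_] := eqVneq w x; first by rewrite (negPf xy).
    by case: (w == y).
  - apply: (f_AT_sink sg (IH z z0 x y u _ _ _)); rewrite ?f3z // 1?eq_sym // => w wz.
    rewrite Nz /f3 (negPf wz); have [->|_] := eqVneq w x; first by rewrite eq_sym (negPf ux).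
    have [->|_] := eqVneq w y; first by rewrite eq_sym (negPf uy).
    by case: (w == u).
have [[p q] /= epq|noe] := pickP [pred a : T * T | e a.1 a.2]; last first.
  exists set0; split.
  - split=> p q; first by rewrite inE.
    by have := noe (p, q); rewrite /= => ->.
  - by apply: (@AT_bipartite _ _ set0) => p q; rewrite inE.
  - move=> v; rewrite /outdeg eq_card0 => [|a]; last by rewrite !inE.
    by rewrite /f3; do 3![case: eqP => // _].
have L3 : #|[set x; y; z]| = 3.
  by rewrite -setUA !cardsU1 cards1 !inE negb_or xy xz yz.
have degN1 v : deg e v != 1.
  have [->//|vz] := eqVneq v z; apply/negP => /eqP v1; have := nsrc v.
  by rewrite /= v1 /f3 (negPf vz); do 2!case: (v == _).
have degN2 v : v \notin [set x; y; z] -> deg e v != 2.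
  rewrite !inE !negb_or -andbA => /and3P[vx vy vz]; apply/negP => /eqP v2.
  by have := nsrc v; rewrite /= v2 /f3 (negPf vx) (negPf vy) (negPf vz).
have [a [b [ab nL edges]]] := K23_of_three_low sg tf K4f L3 degN1 degN2 epq.
exact: AT_extendable_K23 nL edges.
Qed.
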